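(* For every integer $j\ge 1$ and all $x$, \[ U_{j}(x)=2^j\sum_{m=0}^{\left\lfloor j/2\right\rfloor}(-1)^{m+1}\binom{j}{m}\frac{-j+2m-1}{j-m+1}\;{}_{2}F_{1}\!\left(\begin{matrix}-m,\ -j+m-1\\ -j\end{matrix}\,\Big|\,-\tfrac14\right)F_{j-2m+1}(x). \]
   Context: The Fibonacci polynomials are defined by $F_0(x)=0$, $F_1(x)=1$, $F_{n+2}(x)=xF_{n+1}(x)+F_n(x)$ for $n\ge 0$. $U_n(x)$ denotes the Chebyshev polynomial of the second kind, $U_n(\cos\theta)=\sin((n+1)\theta)/\sin\theta$ (equivalently $U_0=1$, $U_1=2x$, $U_n=2xU_{n-1}-U_{n-2}$). For a nonnegative integer $m$, the terminating hypergeometric series is ${}_2F_1\!\left(\begin{smallmatrix}-m,\ b\\ c\end{smallmatrix}\big|z\right)=\sum_{k=0}^{m}\frac{(-m)_k(b)_k}{(c)_k\,k!}z^k$ (here the denominators $(c)_k$ are nonzero), where $(a)_k=a(a+1)\cdots(a+k-1)$. *)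

(* Defs.v *)
From HB Require Import structures.
From mathcomp Require Import all_boot all_order all_algebra.

Set Implicit Arguments.
Unset Strict Implicit.
Unset Printing Implicit Defensive.

Import Order.TTheory GRing.Theory Num.Theory.
Local Open Scope ring_scope.

Fixpoint fib_poly (R : nzRingType) (n : nat) : {poly R} :=
  match n with
  | 0 => 0
  | 1 => 1
  | (n'.+1 as n1).+1 => 'X * fib_poly R n1 + fib_poly R n'
  end.

Fixpoint chebyshevU (R : nzRingType) (n : nat) : {poly R} :=
  match n with
  | 0 => 1
  | 1 => 2%:R *: 'X
  | (n'.+1 as n1).+1 => 2%:R *: 'X * chebyshevU R n1 - chebyshevU R n'
  end.

Definition pochhammer (R : nzRingType) (a : R) (k : nat) : R :=
  \prod_(i < k) (a + i%:R).

(* The terminating series 2F1(-m, b; c | z): the first upper parameter is the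
   opposite of the natural number m. Meaningful only when (c)_k != 0 for all
   k <= m. *)
Definition hyp2F1 (R : fieldType) (m : nat) (b c z : R) : R :=
  \sum_(k < m.+1)
     pochhammer (- m%:R) k * pochhammer b k / (pochhammer c k * k`!%:R)
       * z ^+ k.

(* Main.v *)
(** Expand [U_j] in powers of [x] and each power in Fibonacci polynomials:
    [U_j(x) = \sum_k (-1)^k C(j-k,k) (2x)^(j-2k)] and
    [x^n = \sum_i (-1)^i (C(n,i) - C(n,i-1)) F_(n-2i+1)(x)].
    Collecting the pairs [(k, i)] with [k + i = m], the coefficient of
    [F_(j-2m+1)] is [(-1)^m] times a sum over [k <= m] whose terms are those of
    the hypergeometric series once every factor is written with factorials. *)

Require Import Defs.
From HB Require Import structures.
From mathcomp Require Import all_boot all_order all_algebra.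
From mathcomp Require Import zify ring.

Import Order.TTheory GRing.Theory Num.Theory.
Local Open Scope ring_scope.

(** Induction along the Chebyshev recurrence, with Pascal's rule. Terms with [2 * k > j] vanish, so
    [N] can stay free, and the two induction hypotheses take bounds that line up after the shift of
    [k]. *)
Lemma chebyshevU_expansion (R : comNzRingType) (x : R) (j N : nat) :
  (j < 2 * N)%N ->
  (chebyshevU R j).[x] =
    \sum_(k < N) (-1) ^+ k * 'C(j - k, k)%:R * (2%:R * x) ^+ (j - 2 * k).
Proof.
move: N; have [n] := ubnP j; elim: n j => // n IHn [|[|j]] lt_jn [|N] lt_jN //.
- rewrite big_ord_recl big1 => [|k _]; first by rewrite /= hornerC bin0; ring.
  by rewrite sub0n bin0n mulr0 mul0r.
- rewrite big_ord_recl big1 => [|k _].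
    by rewrite /= hornerZ hornerX bin0 expr1; ring.
  by rewrite /= /bump bin_small ?mulr0 ?mul0r //; lia.
have -> : (chebyshevU R j.+2).[x] =
    2%:R * x * (chebyshevU R j.+1).[x] - (chebyshevU R j).[x].
  by rewrite /= hornerD hornerN hornerM hornerZ hornerX.
rewrite (IHn j.+1 _ N.+1) ?(IHn j _ N); try lia.
rewrite !big_ord_recl !subn0 !bin0 mulrDr -addrA; congr (_ + _).
  by rewrite /= expr0 !mul1r -exprS.
rewrite mulr_sumr -sumrB; apply: eq_bigr => k _.
rewrite /= /bump /= add1n.
have -> : (j.+2 - 2 * k.+1 = j - 2 * k)%N by lia.
have [le_kj|lt_jk] := leqP (2 * k) j; last first.
  by rewrite !bin_small ?mulr0 ?mul0r ?mulr0 ?subr0 //; lia.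
have -> : (j.+2 - k.+1 = (j - k).+1)%N by lia.
rewrite subSS binS natrD exprS.
(* At [j = 2 * k] the exponent [j.+1 - 2 * k.+1] truncates to 0, but its coefficient
   ['C(j - k, k.+1)] is zero. *)
have [eq_kj|lt_kj] := leqP j (2 * k); first by rewrite (@bin_small _ k.+1); [ring|lia].
have -> : (j - 2 * k = (j.+1 - 2 * k.+1).+1)%N by lia.
by rewrite exprS; ring.
Qed.

(** Ballot numbers; the match reads the binomial with lower index -1 as 0. *)
Definition ballot (R : nzRingType) (n i : nat) : R :=
  'C(n, i)%:R - (if i is i'.+1 then 'C(n, i')%:R else 0).

Lemma ballotS (R : nzRingType) (n i : nat) :
  ballot R n.+1 i.+1 = ballot R n i.+1 + ballot R n i.
Proof.
case: i => [|i]; rewrite /ballot !binS ?bin0 !natrD ?subr0; last first.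
  by rewrite opprD addrACA.
by rewrite addrAC.
Qed.

Lemma ballot_middle (R : nzRingType) (n i : nat) :
  (2 * i = n.+1)%N -> ballot R n i = 0.
Proof.
case: i => [|i] eq_in; first by lia.
rewrite /ballot -bin_sub; last by lia.
have -> : (n - i.+1 = i)%N by lia.
by rewrite subrr.
Qed.

(** For [i > 0], [r.+1 * 'C(i + r, i - 1) = i * 'C(i + r, i)]. The product form lets ballot numbers
    be written with factorials. *)
Lemma ballotE (R : comNzRingType) (i r : nat) :
  r.+1%:R * ballot R (i + r) i = (r.+1%:R - i%:R) * 'C(i + r, i)%:R.
Proof.
case: i => [|i]; rewrite /ballot; first by ring.
rewrite mulrBr mulrBl -!natrM mul_bin_left.
by have -> : (i.+1 + r - i = r.+1)%N by lia.
Qed.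

(** This is the Fibonacci recurrence while [2 * i <= n]. Truncated subtraction breaks it at
    [2 * i = n.+1], where the ballot number vanishes; beyond that all three indices are 0. *)
Lemma ballot_mulX_fib (R : comNzRingType) (x : R) (n i : nat) :
  x * (ballot R n i * (fib_poly R (n.+1 - 2 * i)).[x]) =
  ballot R n i * ((fib_poly R (n.+2 - 2 * i)).[x]
                  - (fib_poly R (n - 2 * i)).[x]).
Proof.
have [le_in|lt_ni] := leqP (2 * i) n.
  have -> : (n.+1 - 2 * i = (n - 2 * i).+1)%N by lia.
  have -> : (n.+2 - 2 * i = (n - 2 * i).+2)%N by lia.
  by rewrite [fib_poly R _.+2]/= hornerD hornerM hornerX; ring.
have [eq_in|ne_in] := eqVneq (2 * i)%N n.+1.
  by rewrite ballot_middle // !mul0r mulr0.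
have -> : (n.+1 - 2 * i = 0)%N by lia.
have -> : (n.+2 - 2 * i = 0)%N by lia.
have -> : (n - 2 * i = 0)%N by lia.
by rewrite /= horner0 subrr !mulr0.
Qed.

Lemma exprn_fib_expansion (R : comNzRingType) (x : R) (n N : nat) :
  (n < 2 * N)%N ->
  x ^+ n = \sum_(i < N) (-1) ^+ i * ballot R n i
                        * (fib_poly R (n.+1 - 2 * i)).[x].
Proof.
elim: n N => [|n IHn] [|N] // lt_nN.
  rewrite big_ord_recl big1 => [|i _].
    by rewrite /ballot /= hornerC bin0; ring.
  have -> : (1 - 2 * lift ord0 i = 0)%N by rewrite /= /bump; lia.
  by rewrite horner0 mulr0.
rewrite exprS (IHn N.+1); last by lia.
rewrite mulr_sumr.
under eq_bigr => i _ do
  rewrite -mulrA mulrCA ballot_mulX_fib mulrBr mulrBr.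
(* The last subtracted term carries the zero polynomial; without it the subtracted sum, shifted by
   one, merges with the other through [ballotS]. *)
rewrite sumrB [X in _ - X]big_ord_recr /=.
have -> : (n - 2 * N = 0)%N by lia.
rewrite horner0 !mulr0 addr0 big_ord_recl [in RHS]big_ord_recl -addrA.
congr (_ + _); first by rewrite /ballot !bin0 mulrA.
rewrite -sumrB; apply: eq_bigr => i _.
rewrite /= /bump /= add1n ballotS exprS.
have -> : (n.+2 - 2 * i.+1 = n - 2 * i)%N by lia.
by ring.
Qed.

(** For [m <= j] all three parameters of the series are opposites of naturals, so its terms reduce
    to falling factorials. *)
Lemma pochhammer_oppn (R : comNzRingType) (n k : nat) :
  pochhammer (- n%:R : R) k = (-1) ^+ k * (n ^_ k)%:R.
Proof.
rewrite /pochhammer; elim: k => [|k IHk]; first by rewrite big_ord0 ffactn0 mulr1.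
rewrite big_ord_recr /= IHk ffactnSr natrM exprS.
have [le_kn|lt_nk] := leqP k n; first by rewrite natrB //; ring.
by rewrite ffact_small //; ring.
Qed.

Lemma natr_fact_neq0 (R : numDomainType) (n : nat) : n`!%:R != 0 :> R.
Proof. by rewrite pnatr_eq0 -lt0n fact_gt0. Qed.

Lemma natr_ffact (R : numFieldType) (n k : nat) :
  ((n + k) ^_ k)%:R = (n + k)`!%:R / n`!%:R :> R.
Proof.
apply: (canRL (mulfK (natr_fact_neq0 R n))).
by rewrite -natrM -(ffact_fact (leq_addl n k)) addnK.
Qed.

Lemma natr_bin (R : numFieldType) (n k : nat) :
  'C(n + k, k)%:R = (n + k)`!%:R / (k`!%:R * n`!%:R) :> R.
Proof.
have nz := mulf_neq0 (natr_fact_neq0 R k) (natr_fact_neq0 R n).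
apply: (canRL (mulfK nz)).
by rewrite -!natrM -(bin_fact (leq_addl n k)) addnK.
Qed.

(* Here [j = 2 k + i + r] and [m = k + i]; this parametrisation makes every
   truncated difference in the two expansions a sum. *)
Lemma hyp2F1_term (R : numFieldType) (k i r : nat) :
  let j := (2 * k + i + r)%N in let m := (k + i)%N in
  (-1) ^+ m.+1 * 'C(j, m)%:R * ((- j%:R + 2%:R * m%:R - 1) / (j%:R - m%:R + 1))
  * (pochhammer (- m%:R) k * pochhammer (- j%:R + m%:R - 1) k
     / (pochhammer (- j%:R) k * k`!%:R) * (- (1 / 4%:R)) ^+ k)
  = (-1) ^+ m * 'C(j - k, k)%:R * ballot R (j - 2 * k) i / 4%:R ^+ k :> R.
Proof.
move=> j m.
have eb : - j%:R + m%:R - 1 = - (r.+1 + k)%:R :> R.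
  by rewrite /j /m; ring.
have ed : j%:R - m%:R + 1 = (r.+1 + k)%:R :> R.
  by rewrite /j /m; ring.
have en : - j%:R + 2%:R * m%:R - 1 = - (r.+1%:R - i%:R) :> R.
  by rewrite /j /m; ring.
have nz n : n.+1%:R != 0 :> R by rewrite pnatr_eq0.
have -> : (j - k = (i + r) + k)%N by rewrite /j; lia.
have -> : (j - 2 * k = i + r)%N by rewrite /j; lia.
have -> : ballot R (i + r) i = (r.+1%:R - i%:R) * 'C(i + r, i)%:R / r.+1%:R.
  by apply: (canRL (mulfK (nz r))); rewrite mulrC ballotE.
rewrite eb ed en !pochhammer_oppn.
have -> : j = ((i + r + k) + k)%N by rewrite /j; lia.
have -> : m = (i + k)%N by rewrite /m addnC.
rewrite !natr_ffact.
have -> : (i + r + k + k = (r + k) + (i + k))%N by lia.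
rewrite !natr_bin [(i + r)%N]addnC natr_bin addSn !factS !natrM.
have nf := natr_fact_neq0 R.
have nz4 : 4%:R ^+ k != 0 :> R by rewrite expf_neq0.
have -> : (- (1 / 4%:R)) ^+ k = (-1) ^+ k / 4%:R ^+ k :> R.
  by rewrite mul1r [LHS]exprNn exprVn.
(* Splitting on the parity of [k] makes each [(-1) ^+ k] explicit and leaves a rational identity in
   factorials. *)
rewrite exprS exprD -[(-1) ^+ k]signr_odd.
move: nz4; set q := 4%:R ^+ k => nz4.
by case: (odd k); rewrite ?expr0 ?expr1; field;
   rewrite nz4 !nf -natrD !nat1r !nz.
Qed.

Theorem theorem2 (R : numFieldType) (j : nat) (x : R) (hj : (1 <= j)%N) :
  (chebyshevU R j).[x] =
    2%:R ^+ j *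
    \sum_(0 <= m < (j %/ 2).+1)
       (-1) ^+ m.+1 * 'C(j, m)%:R
       * ((- j%:R + 2%:R * m%:R - 1) / (j%:R - m%:R + 1))
       * hyp2F1 m (- j%:R + m%:R - 1) (- j%:R) (- (1 / 4%:R))
       * (fib_poly R (j - 2 * m + 1)).[x].
Proof.
have lt_j2 : (j < 2 * (j %/ 2).+1)%N by lia.
rewrite (@chebyshevU_expansion _ _ _ _ lt_j2).
(* The contribution of the pair [(k, i)] with [i = m - k]. *)
pose t m k : R := 2%:R ^+ j * ((-1) ^+ m * 'C(j - k, k)%:R
  * ballot R (j - 2 * k) (m - k) / 4%:R ^+ k) * (fib_poly R (j - 2 * m + 1)).[x].
transitivity (\sum_(0 <= k < (j %/ 2).+1) \sum_(k <= m < (j %/ 2).+1) t m k).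
  rewrite big_mkord; apply: eq_bigr => -[k /= lt_k] _.
  rewrite exprMn (@exprn_fib_expansion _ x _ ((j %/ 2).+1 - k)); last by lia.
  rewrite -[X in \sum_(X <= _ < _) _]add0n big_addn big_mkord !mulr_sumr.
  apply: eq_bigr => -[i /= lt_i] _.
  have -> : ((j - 2 * k).+1 - 2 * i = j - 2 * (i + k) + 1)%N by lia.
  (* The factor [2 ^+ (j - 2 * k)] of [(2 * x) ^+ (j - 2 * k)] is [2 ^+ j / 4 ^+ k], whence the 1/4
     in the argument of the series. *)
  have e2 : 2%:R ^+ j = 2%:R ^+ (j - 2 * k) * 4%:R ^+ k :> R.
    have -> : 4%:R = 2%:R ^+ 2 :> R by ring.
    by rewrite -exprM -exprD subnK //; lia.
  have nz4 : 4%:R ^+ k != 0 :> R by rewrite expf_neq0 ?pnatr_eq0.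
  by rewrite /t addnK e2 exprD; field.
(* Summation over the triangle [k <= m] is exchanged, so that each [m] collects its [k <= m]. *)
under eq_bigr => k _ do rewrite (@big_nat_widenl _ _ _ k 0) //.
rewrite (exchange_big_dep_nat xpredT) //= mulr_sumr.
rewrite big_mkord [in RHS]big_mkord; apply: eq_bigr => -[m /= lt_m] _.
rewrite -[LHS](@big_nat_widen _ _ _ 0 m.+1 _ xpredT) // big_mkord.
rewrite /hyp2F1 mulr_sumr mulr_suml mulr_sumr; apply: eq_bigr => -[k /= le_k] _.
(* The remainder [r = j - k - m] is not truncated, since [k <= m] and [2 * m <= j]. *)
have ej : (2 * k + (m - k) + (j - k - m) = j)%N by lia.
have em : (k + (m - k) = m)%N by lia.
have := hyp2F1_term R k (m - k) (j - k - m).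
by rewrite /= ej em => ->; rewrite /t !mulrA.
Qed.
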